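(* Let $V\subset\mathbb{R}^3$ be a (single- or multi-patch) spline domain with control mesh $V_C$, let $S_p^k(V)$ and $Z_h^k(V_C)$, $k=0,\dots,3$, be the spline spaces on $V$ and the lowest order finite element spaces on $V_C$, and let $I_h^k:S_p^k(V)\to Z_h^k(V_C)$ be the canonical commuting isomorphisms. Let $$\tilde H(V)=\frac{\operatorname{Ker}\big(\operatorname{curl}:S_p^1(V)\to S_p^2(V)\big)}{\operatorname{Im}\big(\operatorname{grad}:S_p^0(V)\to S_p^1(V)\big)},\qquad \tilde H(V_C)=\frac{\operatorname{Ker}\big(\operatorname{curl}:Z_h^1(V_C)\to Z_h^2(V_C)\big)}{\operatorname{Im}\big(\operatorname{grad}:Z_h^0(V_C)\to Z_h^1(V_C)\big)}$$ be the first cohomology groups for splines in $V$ and for low order finite elements in $V_C$. Then $$\dim \tilde H(V)=\dim\tilde H(V_C)=:N_H .$$ Moreover, functions $\{\tilde{\boldsymbol h}_{h,j}\}_{j=1}^{N_H}\subset S_p^1(V)$ are generators of the first cohomology group $\tilde H(V)$ if and only if $\{I_h^1(\tilde{\boldsymbol h}_{h,j})\}_{j=1}^{N_H}\subset Z_h^1(V_C)$ are generators of the first cohomology group $\tilde H(V_C)$.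
   Context: **Generators.** Functions $u_1,\dots,u_{N_H}$ are generators of a quotient $\operatorname{Ker}(\operatorname{curl})/\operatorname{Im}(\operatorname{grad})$ of dimension $N_H$ if they all lie in $\operatorname{Ker}(\operatorname{curl})$ and their classes generate (equivalently, form a basis of) the quotient. **Univariate splines.** Let $p\ge 1$ and let $\Xi=\{\xi_1\le\dots\le\xi_{n+p+1}\}\subset[0,1]$ be an open knot vector (first and last knots repeated exactly $p+1$ times; interior knots repeated at most $p$ times). Let $\hat B_i^p$, $i=1,\dots,n$, be the B-splines of degree $p$ (Cox–de Boor), spanning $S_p(\Xi)$. Let $\Xi'$ be $\Xi$ with its first and last knots removed, $\xi'_i=\xi_{i+1}$. The space $S_{p-1}(\Xi')$ has the Curry–Schoenberg basis $\hat D_i^{p-1}=\frac{p}{\xi'_{i+p}-\xi'_i}\hat B_i^{p-1}$, $i=1,\dots,n-1$ (B-splines of degree $p-1$ on $\Xi'$), so that $(\hat B_i^p)'=\hat D_{i-1}^{p-1}-\hat D_i^{p-1}$ with the convention $\hat D_0^{p-1}=\hat D_n^{p-1}=0$. **Spline spaces on one patch.** On $\hat V=(0,1)^3$, with knot vectors $\Xi_1,\Xi_2,\Xi_3$, let $S_{q_1,q_2,q_3}$ denote the tensor product of univariate spline spaces of degree $q_j\in\{p,p-1\}$, using $\Xi_j$ when $q_j=p$ and $\Xi_j'$ when $q_j=p-1$. Put - $S_p^0(\hat V)=S_{p,p,p}$, - $S_p^1(\hat V)=S_{p-1,p,p}\times S_{p,p-1,p}\times S_{p,p,p-1}$, - $S_p^2(\hat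 V)=S_{p,p-1,p-1}\times S_{p-1,p,p-1}\times S_{p-1,p-1,p}$, - $S_p^3(\hat V)=S_{p-1,p-1,p-1}$. Bases are given by tensor products of the $\hat B_i^p$ and the $\hat D_i^{p-1}$. A patch is the image of a (sufficiently smooth, invertible) map $\mathbf F(\boldsymbol\xi)=\sum_{\mathbf i}\mathbf P_{\mathbf i}\hat B^p_{\mathbf i}(\boldsymbol\xi)$ with control points $\mathbf P_{\mathbf i}\in\mathbb R^3$, $\mathbf i=(i_1,i_2,i_3)$, $1\le i_k\le n_k$ (NURBS maps are also allowed). The spaces $S_p^k$ on the patch are the images of $S_p^k(\hat V)$ under the standard pull-backs for 0-, 1-, 2- and 3-forms, i.e. $u\circ\mathbf F=\hat u$; $\mathbf u\circ\mathbf F=D\mathbf F^{-\top}\hat{\mathbf u}$; $\mathbf u\circ\mathbf F=(\det D\mathbf F)^{-1}D\mathbf F\,\hat{\mathbf u}$; $u\circ\mathbf F=(\det D\mathbf F)^{-1}\hat u$, respectively. **Multi-patch domains.** $\overline V=\bigcup_{j=1}^N\overline{V^{(j)}}$ is a conforming partition into such patches: on every interface between patches the parametrizations and knot vectors coincide up to an affine transformation, so control points on the interface coincide and interface basis functions are in one-to-one correspondence. The spaces $S_p^0(V),S_p^1(V),S_p^2(V),S_p^3(V)$ consist of the functions in $H^1(V)$, $\mathbf H(\mathbf{curl};V)$, $\mathbf H(\operatorname{div};V)$, $L^2(V)$, respectively, whose restriction to each $V^{(j)}$ lies in $S_p^k(V^{(j)})$. Bases are obtained by gluing the patchwise basis functions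 that correspond to each other across interfaces, with signs determined by a choice of orientation. This gives the sequence $S_p^0(V)\xrightarrow{\operatorname{grad}}S_p^1(V)\xrightarrow{\operatorname{curl}}S_p^2(V)\xrightarrow{\operatorname{div}}S_p^3(V)$. **Control mesh.** On each patch the control points are the vertices of a structured mesh of trilinear hexahedra (its cells have vertices $\mathbf P_{\mathbf i+\boldsymbol\epsilon}$, $\boldsymbol\epsilon\in\{0,1\}^3$). The control mesh $V_C$ is the global hexahedral mesh obtained by identifying coinciding control points, edges and faces on patch interfaces. On it, $Z_h^0(V_C)$ is the space of lowest order nodal elements, $Z_h^1(V_C)$ of lowest order edge elements, $Z_h^2(V_C)$ of lowest order face elements, and $Z_h^3(V_C)$ of piecewise constants, giving $Z_h^0(V_C)\xrightarrow{\operatorname{grad}}Z_h^1(V_C)\xrightarrow{\operatorname{curl}}Z_h^2(V_C)\xrightarrow{\operatorname{div}}Z_h^3(V_C)$. Their standard basis functions are associated with the (oriented) vertices, edges, faces and cells of $V_C$. **The isomorphisms.** The basis functions of $S_p^0(V),\dots,S_p^3(V)$ are likewise in one-to-one correspondence with the vertices, edges, faces and cells of $V_C$. On a patch, $\hat B_{i_1}\hat B_{i_2}\hat B_{i_3}$ corresponds to the vertex $\mathbf P_{\mathbf i}$; replacing $\hat B_{i_k}$ by $\hat D_{i_k}$ in exactly one direction $k$ gives the edge from $\mathbf P_{\mathbf i}$ to $\mathbf P_{\mathbf i+\mathbf e_k}$; replacing in two directions gives a face; replacing in all three gives a cell. $I_h^k:S_p^k(V)\to Z_h^k(V_C)$ is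 the linear map sending each spline basis function to the finite element basis function associated with the same oriented geometric entity. It is a known fact, which may be used, that the $I_h^k$ are isomorphisms commuting with the differential operators: $\operatorname{grad} I_h^0=I_h^1\operatorname{grad}$, $\operatorname{curl} I_h^1=I_h^2\operatorname{curl}$, $\operatorname{div} I_h^2=I_h^3\operatorname{div}$. *)

(* Defs.v *)
From HB Require Import structures.
From mathcomp Require Import all_boot all_order all_algebra all_fingroup.
From mathcomp Require Import all_classical all_reals all_analysis.

Set Implicit Arguments.
Unset Strict Implicit.
Unset Printing Implicit Defensive.

Import Order.TTheory GRing.Theory Num.Theory.
Import numFieldNormedType.Exports.

Local Open Scope classical_set_scope.
Local Open Scope ring_scope.

(** * Functions on open subsets of R^3

    Points and vector fields are row vectors.  A function on an open set [D] is
    given by a representative, i.e. a total function of which only the a.e.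
    class on [D] matters.  All the function spaces below are stable under a.e.
    equality of (Borel) measurable functions, and linear maps between them are
    linear up to a.e. equality. *)

Notation pt R := 'rV[R]_3.
Notation scal3 R := ('rV[R]_3 -> R).
Notation vect3 R := ('rV[R]_3 -> 'rV[R]_3).

Section Analysis.
Variable R : realType.

Local Notation R3 :=
  (measurableTypeR R * measurableTypeR R * measurableTypeR R)%type.

Definition leb3 : {measure set R3 -> \bar R} :=
  ((@lebesgue_measure R \x @lebesgue_measure R) \x @lebesgue_measure R)%E.

(** The library puts a measurable structure on iterated products but not on
    row vectors; [vec3] is the identification used for a.e. and integrals. *)
Definition vec3 (t : R3) : pt R :=
  \row_(a < 3) nth 0 [:: t.1.1; t.1.2; t.2] a.

Definition integral3 (D : set (pt R)) (f : scal3 R) : R :=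
  \int[leb3]_(t in vec3 @^-1` D) f (vec3 t).

Definition aeq (W : Type) (D : set (pt R)) (u v : pt R -> W) : Prop :=
  {ae leb3, forall t, D (vec3 t) -> u (vec3 t) = v (vec3 t)}.

Definition L2 (D : set (pt R)) (f : scal3 R) : Prop :=
  (fun t => (f \_ D) (vec3 t)) \in Lfun leb3 2%:E.

Definition vcomp (a : 'I_3) (u : vect3 R) : scal3 R := fun x => u x 0 a.

Definition L2v (D : set (pt R)) (u : vect3 R) : Prop :=
  forall a, L2 D (vcomp a u).

Definition partial (a : 'I_3) (f : scal3 R) : scal3 R :=
  fun x => 'D_(delta_mx 0 a : pt R) (f : pt R -> R^o) x.

Definition smooth (f : scal3 R) : Prop :=
  forall s : seq 'I_3,
    continuous (foldr partial f s) /\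
    forall a x, derivable (foldr partial f s : pt R -> R^o) x (delta_mx 0 a).

Definition test_function (D : set (pt R)) (f : scal3 R) : Prop :=
  smooth f /\
  exists K : set (pt R),
    [/\ compact K, K `<=` D & forall x, ~ K x -> f x = 0].

(** [ordS a] and [ord_pred a] are a+1 and a+2 modulo 3. *)
Definition curl_test (psi : 'I_3 -> scal3 R) (a : 'I_3) : scal3 R :=
  fun x => partial (ordS a) (psi (ord_pred a)) x
           - partial (ord_pred a) (psi (ordS a)) x.

(** Distributional differential operators on [D].  As their values are only
    determined a.e., each operator is given by its graph:
    [is_curl D u w] reads "w = curl u on D". *)
Definition is_grad (D : set (pt R)) (phi : scal3 R) (u : vect3 R) : Prop :=
  forall psi a, test_function D psi ->
    integral3 D (fun x => phi x * partial a psi x)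
    = - integral3 D (fun x => u x 0 a * psi x).

Definition is_curl (D : set (pt R)) (u w : vect3 R) : Prop :=
  forall psi : 'I_3 -> scal3 R, (forall a, test_function D (psi a)) ->
    integral3 D (fun x => \sum_a u x 0 a * curl_test psi a x)
    = integral3 D (fun x => \sum_a w x 0 a * psi a x).

Definition is_div (D : set (pt R)) (u : vect3 R) (rho : scal3 R) : Prop :=
  forall psi, test_function D psi ->
    integral3 D (fun x => \sum_a u x 0 a * partial a psi x)
    = - integral3 D (fun x => rho x * psi x).

Definition H1 (D : set (pt R)) (phi : scal3 R) : Prop :=
  L2 D phi /\ exists u, L2v D u /\ is_grad D phi u.

Definition Hcurl (D : set (pt R)) (u : vect3 R) : Prop :=
  L2v D u /\ exists w, L2v D w /\ is_curl D u w.

Definition Hdiv (D : set (pt R)) (u : vect3 R) : Prop :=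
  L2v D u /\ exists rho, L2 D rho /\ is_div D u rho.

Definition cube : set (pt R) := [set xi | forall a, 0 < xi 0 a < 1].
Definition ccube : set (pt R) := [set xi | forall a, 0 <= xi 0 a <= 1].

End Analysis.

(** * Univariate splines (indices start at 0) *)

Section Univariate.
Variable R : realType.
Implicit Types (s : seq R) (x : R).

Definition open_knots (p : nat) s : Prop :=
  [/\ sorted <=%R s, {in s, forall x, 0 <= x <= 1},
      count_mem 0 s = p.+1, count_mem 1 s = p.+1
    & forall x, 0 < x < 1 -> (count_mem x s <= p)%N].

(** Cox-de Boor recursion, with 0/0 = 0.  The last nonempty knot span is closed
    on the right, so that splines are left continuous at the last knot. *)
Fixpoint bspline s (q i : nat) x : R :=
  if q is q'.+1 then
    (x - s`_i) / (s`_(i + q) - s`_i) * bspline s q' i x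
    + (s`_(i + q).+1 - x) / (s`_(i + q).+1 - s`_i.+1) * bspline s q' i.+1 x
  else ((s`_i <= x < s`_i.+1)
        || [&& s`_i < s`_i.+1, s`_i.+1 == last 0 s & x == last 0 s])%:R.

Definition inner_knots s : seq R := behead (take (size s).-1 s).

(** Curry-Schoenberg spline of degree [p.-1] on [inner_knots s]. *)
Definition dspline s (p i : nat) x : R :=
  let s' := inner_knots s in
  p%:R / (s'`_(i + p) - s'`_i) * bspline s' p.-1 i x.

End Univariate.

(** * Patches *)

Record nurbs_patch (R : realType) := NurbsPatch {
  knots : 'I_3 -> seq R;
  ctrl : ('I_3 -> nat) -> 'rV[R]_3;
  weight : ('I_3 -> nat) -> R }.

Section Patch.
Variables (R : realType) (p : nat) (Q : nurbs_patch R).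

Definition dimn (a : 'I_3) : nat := size (knots Q a) - p.+1.

(** [A] is the set of directions in which the degree is lowered to [p.-1]. *)
Definition midx (A : {set 'I_3}) : finType :=
  {dffun forall a : 'I_3, 'I_(dimn a - (a \in A))}.

Definition idx (A : {set 'I_3}) (i : midx A) : 'I_3 -> nat :=
  fun a => nat_of_ord (i a).

Definition tensor (A : {set 'I_3}) (i : midx A) : scal3 R := fun xi =>
  \prod_(a < 3) (if a \in A then dspline (knots Q a) p (idx i a) (xi 0 a)
                 else bspline (knots Q a) p (idx i a) (xi 0 a)).

Definition tcomb (A : {set 'I_3}) (c : midx A -> R) : scal3 R :=
  fun xi => \sum_(i : midx A) c i * tensor i xi.

(** NURBS parametrization; it is the B-spline one when all weights are 1, as
    B-splines sum to 1. *)
Definition pmap (xi : pt R) : pt R :=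
  (\sum_(i : midx finset.set0) weight Q (idx i) * tensor i xi)^-1 *:
  \sum_(i : midx finset.set0) (weight Q (idx i) * tensor i xi) *: ctrl Q (idx i).

(** The library's Jacobian acts on row vectors from the right, hence is the
    transpose of the usual matrix. *)
Definition DF (xi : pt R) : 'M[R]_3 := ('J pmap xi)^T.

(** Spline spaces on the reference cube. *)
Definition tspace (A : {set 'I_3}) : set (scal3 R) := range (@tcomb A).

Definition Sref0 : set (scal3 R) := tspace finset.set0.
Definition Sref1 : set (vect3 R) :=
  [set g | forall a, tspace [set a] (vcomp a g)].
Definition Sref2 : set (vect3 R) :=
  [set g | forall a, tspace (~: [set a]) (vcomp a g)].
Definition Sref3 : set (scal3 R) := tspace [set: 'I_3].

(** [is_push W G u]: on the patch, [u (F xi) = G xi] a.e. *)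
Definition is_push (W : Type) (G : pt R -> W) (u : pt R -> W) : Prop :=
  {ae leb3 R, forall t xi, cube xi -> pmap xi = vec3 t -> u (vec3 t) = G xi}.

(** The pull-backs of k-forms, transposed since vector fields are rows. *)
Definition push0 (g : scal3 R) (u : scal3 R) : Prop := is_push g u.
Definition push1 (g : vect3 R) (u : vect3 R) : Prop :=
  is_push (fun xi => g xi *m invmx (DF xi)) u.
Definition push2 (g : vect3 R) (u : vect3 R) : Prop :=
  is_push (fun xi => (\det (DF xi))^-1 *: (g xi *m (DF xi)^T)) u.
Definition push3 (g : scal3 R) (u : scal3 R) : Prop :=
  is_push (fun xi => (\det (DF xi))^-1 * g xi) u.

(** "Sufficiently smooth and invertible": bi-Lipschitz on the closed cube.  (A
    knot of multiplicity [p] only allows a piecewise smooth map.) *)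
Definition regular_map : Prop :=
  exists2 L : R, 0 < L & forall xi eta, ccube xi -> ccube eta ->
    `|pmap xi - pmap eta| <= L * `|xi - eta| /\
    `|xi - eta| <= L * `|pmap xi - pmap eta|.

Definition spline_patch : Prop :=
  [/\ forall a, open_knots p (knots Q a),
      forall i : midx finset.set0, 0 < weight Q (idx i)
    & regular_map].

(** Oriented geometric entities of the control mesh, as lists of vertices.  An
    edge is a pair; the face with directions a+1, a+2 is the 4-cycle whose
    orientation corresponds to the a-th component of a 2-form; a cell is the
    list of its 8 vertices, in a fixed order. *)
Definition shift_idx (i : 'I_3 -> nat) (E : {set 'I_3}) : 'I_3 -> nat :=
  fun a => (i a + (a \in E))%N.

Definition vertex_at (i : 'I_3 -> nat) : seq (pt R) := [:: ctrl Q i].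

Definition edge_at (a : 'I_3) (i : 'I_3 -> nat) : seq (pt R) :=
  [:: ctrl Q i; ctrl Q (shift_idx i [set a])].

Definition face_at (a : 'I_3) (i : 'I_3 -> nat) : seq (pt R) :=
  [:: ctrl Q i; ctrl Q (shift_idx i [set ordS a]);
      ctrl Q (shift_idx i (~: [set a])); ctrl Q (shift_idx i [set ord_pred a])].

Definition cell_at (i : 'I_3 -> nat) : seq (pt R) :=
  [seq ctrl Q (shift_idx i E) | E : {set 'I_3}].

End Patch.

(** * Conforming families of patches *)

(** A closed face (2-face, edge or vertex) of the cube is encoded by
    [f : 'I_3 -> option bool]: coordinate [a] is fixed to [b] when
    [f a = Some b] and free when [f a = None].  An affine map between closed
    faces is the restriction of a symmetry of the cube: direction [a] goes to
    direction [s a] and is reversed when [r a]. *)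

Section Conforming.
Variables (R : realType) (p : nat).

Definition in_face (f : 'I_3 -> option bool) (xi : pt R) : Prop :=
  ccube xi /\ forall a b, f a = Some b -> xi 0 a = b%:R.

Definition symcube (s : {perm 'I_3}) (r : 'I_3 -> bool) (xi : pt R) : pt R :=
  \row_b (let a := (s^-1)%g b in if r a then 1 - xi 0 a else xi 0 a).

Definition valid_idx (Q : nurbs_patch R) (i : 'I_3 -> nat) : Prop :=
  forall a, (i a < dimn p Q a)%N.

(** The control point [i] of [Q] lies on the face [f] and [i'] is the
    corresponding control point of [Q']. *)
Definition idx_match (Q Q' : nurbs_patch R) (f : 'I_3 -> option bool)
    (s : {perm 'I_3}) (r : 'I_3 -> bool) (i i' : 'I_3 -> nat) : Prop :=
  forall a, match f a with
    | None => i' (s a) = if r a then ((dimn p Q a).-1 - i a)%N else i a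
    | Some b => i a = (if b then (dimn p Q a).-1 else 0%N) /\
        i' (s a) = (if b (+) r a then (dimn p Q' (s a)).-1 else 0%N)
    end.

(** [Q] and [Q'] are glued along the face [f] of [Q]: up to the affine map, the
    parametrizations and the knot vectors, hence the control points, agree. *)
Definition interface (Q Q' : nurbs_patch R) (f : 'I_3 -> option bool)
    (s : {perm 'I_3}) (r : 'I_3 -> bool) : Prop :=
  [/\ forall xi, in_face f xi -> pmap p Q xi = pmap p Q' (symcube s r xi),
      forall a, f a = None -> knots Q' (s a) =
        if r a then rev [seq 1 - x | x <- knots Q a] else knots Q a
    & forall i i', valid_idx Q i -> valid_idx Q' i' ->
        idx_match Q Q' f s r i i' -> ctrl Q i = ctrl Q' i'].

Definition conforming (J : finType) (M : J -> nurbs_patch R) : Prop :=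
  forall j j', j != j' ->
    pmap p (M j) @` @cube R `&` pmap p (M j') @` @cube R = set0 /\
    forall xi eta, ccube xi -> ccube eta ->
      pmap p (M j) xi = pmap p (M j') eta ->
      exists f s r, [/\ interface (M j) (M j') f s r, in_face f xi
                      & eta = symcube s r xi].

Definition multipatch (J : finType) (M : J -> nurbs_patch R) : Prop :=
  (forall j, spline_patch p (M j)) /\ conforming M.

(** The open set V such that the closure of V is the union of the closed
    patches. *)
Definition domain (J : finType) (M : J -> nurbs_patch R) : set (pt R) :=
  interior (\bigcup_(j in [set: J]) closure (pmap p (M j) @` @cube R)).

(** * The spaces S_p^k(V) *)

Definition S0 (J : finType) (M : J -> nurbs_patch R) (u : scal3 R) : Prop :=
  H1 (domain M) u /\
  forall j, exists2 g, Sref0 p (M j) g & push0 p (M j) g u.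

Definition S1 (J : finType) (M : J -> nurbs_patch R) (u : vect3 R) : Prop :=
  Hcurl (domain M) u /\
  forall j, exists2 g, Sref1 p (M j) g & push1 p (M j) g u.

Definition S2 (J : finType) (M : J -> nurbs_patch R) (u : vect3 R) : Prop :=
  Hdiv (domain M) u /\
  forall j, exists2 g, Sref2 p (M j) g & push2 p (M j) g u.

Definition S3 (J : finType) (M : J -> nurbs_patch R) (u : scal3 R) : Prop :=
  L2 (domain M) u /\
  forall j, exists2 g, Sref3 p (M j) g & push3 p (M j) g u.

(** * Basis functions

    [basisk M sigma u]: [u] is the basis function of degree k associated with
    the oriented entity [sigma], that is, the gluing of the patchwise basis
    functions of the entities which coincide with [sigma], with sign -1 when
    the orientation given by the patch is opposite.  (If [sigma] is not an
    entity of the mesh, this says that [u] is zero.) *)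

Definition sgn_id (sigma tau : seq (pt R)) : R := (tau == sigma)%:R.

Definition sgn_edge (sigma tau : seq (pt R)) : R :=
  (tau == sigma)%:R - (tau == rev sigma)%:R.

Definition same_cycle (sigma tau : seq (pt R)) : bool :=
  tau \in [seq rot k sigma | k <- iota 0 4].

Definition sgn_face (sigma tau : seq (pt R)) : R :=
  (same_cycle sigma tau)%:R - (same_cycle (rev sigma) tau)%:R.

Definition basis0 (J : finType) (M : J -> nurbs_patch R) sigma (u : scal3 R) : Prop :=
  forall j, push0 p (M j)
    (tcomb (fun i : midx p (M j) finset.set0 =>
              sgn_id sigma (vertex_at (M j) (idx i)))) u.

Definition basis1 (J : finType) (M : J -> nurbs_patch R) sigma (u : vect3 R) : Prop :=
  forall j, push1 p (M j)
    (fun xi => \row_a tcomb (fun i : midx p (M j) [set a] =>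
              sgn_edge sigma (edge_at (M j) a (idx i))) xi) u.

Definition basis2 (J : finType) (M : J -> nurbs_patch R) sigma (u : vect3 R) : Prop :=
  forall j, push2 p (M j)
    (fun xi => \row_a tcomb (fun i : midx p (M j) (~: [set a]) =>
              sgn_face sigma (face_at (M j) a (idx i))) xi) u.

Definition basis3 (J : finType) (M : J -> nurbs_patch R) sigma (u : scal3 R) : Prop :=
  forall j, push3 p (M j)
    (tcomb (fun i : midx p (M j) [set: 'I_3] =>
              sgn_id sigma (cell_at (M j) (idx i)))) u.

End Conforming.

(** * The control mesh and the lowest order finite elements *)

Section ControlMesh.
Variable R : realType.

(** A trilinear hexahedron is the B-spline patch of degree 1 on the knots
    0,0,1,1.  By the next lemma, S_1^k on such a patch is the lowest
    order space: Q_{1,1,1} for k = 0, Q_{0,1,1} x Q_{1,0,1} x Q_{1,1,0} for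
    k = 1, Q_{1,0,0} x Q_{0,1,0} x Q_{0,0,1} for k = 2, constants for k = 3. *)
Definition hex_knots : seq R := [:: 0; 0; 1; 1].

Lemma hex_knotsE (x : R) : 0 <= x <= 1 ->
  [/\ bspline hex_knots 1 0 x = 1 - x, bspline hex_knots 1 1 x = x
    & dspline hex_knots 1 0 x = 1].
Proof.
rewrite /dspline /= => /andP[x0]; rewrite le_eqVlt => /orP[/eqP->|x1].
  rewrite ?ltxx ?lexx ?ltr01 ?eqxx ?andbF /=.
  by rewrite ?(subrr, subr0, mul0r, mulr0, divr1, invr0, mulr1, add0r, addr0).
rewrite ?ltxx ?lexx ?ltr01 ?eqxx ?andbF x0 x1 (lt_eqF x1) /=.
by rewrite ?(subrr, subr0, mul0r, mulr0, divr1, invr0, mulr1, add0r, addr0,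
  mul1r).
Qed.

Definition hexahedron (v : ('I_3 -> nat) -> pt R) : nurbs_patch R :=
  NurbsPatch (fun=> hex_knots) v (fun=> 1).

Variables (p : nat) (J : finType) (V : J -> nurbs_patch R).

Definition cell : finType := {j : J & midx p (V j) [set: 'I_3]}.

Definition control_mesh (c : cell) : nurbs_patch R :=
  hexahedron (fun eps =>
    ctrl (V (tag c)) (fun a => (idx (tagged c) a + eps a)%N)).

(** The control mesh is a conforming mesh of (nondegenerate) hexahedra in which
    two control points coincide only if they are identified on an interface. *)
Definition valid_control_mesh : Prop :=
  multipatch 1 control_mesh /\
  forall j j' i i', valid_idx p (V j) i -> valid_idx p (V j') i' ->
    ctrl (V j) i = ctrl (V j') i' ->
    (j = j' /\ i = i') \/
    exists f s r, interface p (V j) (V j') f s r /\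
                  idx_match p (V j) (V j') f s r i i'.

Definition VC : set (pt R) := domain 1 control_mesh.

Definition Z0 : set (scal3 R) := S0 1 control_mesh.
Definition Z1 : set (vect3 R) := S1 1 control_mesh.
Definition Z2 : set (vect3 R) := S2 1 control_mesh.
Definition Z3 : set (scal3 R) := S3 1 control_mesh.

(** * The canonical isomorphisms *)

Definition ae_isomorphism (W : lmodType R) (D D' : set (pt R))
    (S S' : set (pt R -> W)) (I : (pt R -> W) -> (pt R -> W)) : Prop :=
  [/\ forall u, S u -> S' (I u),
      forall (a : R) u v, S u -> S v ->
        aeq D' (I (a *: u + v)) (a *: I u + I v),
      forall u v, S u -> S v -> (aeq D' (I u) (I v) <-> aeq D u v)
    & forall v, S' v -> exists2 u, S u & aeq D' (I u) v].

Local Notation D := (domain p V).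

(** Commutation is stated on graphs, the operators being given by theirs: for
    instance [grad I0 = I1 grad] reads, for [phi] in S_p^0(V) and [u] in
    S_p^1(V), "u = grad phi iff I1 u = grad (I0 phi)". *)
Record canonical_isomorphisms (I0 : scal3 R -> scal3 R) (I1 : vect3 R -> vect3 R)
    (I2 : vect3 R -> vect3 R) (I3 : scal3 R -> scal3 R) : Prop := {
  iso0 : @ae_isomorphism R^o D VC (S0 p V) Z0 I0;
  iso1 : ae_isomorphism D VC (S1 p V) Z1 I1;
  iso2 : ae_isomorphism D VC (S2 p V) Z2 I2;
  iso3 : @ae_isomorphism R^o D VC (S3 p V) Z3 I3;
  can0 : forall sigma u, S0 p V u ->
    basis0 p V sigma u -> basis0 1 control_mesh sigma (I0 u);
  can1 : forall sigma u, S1 p V u ->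
    basis1 p V sigma u -> basis1 1 control_mesh sigma (I1 u);
  can2 : forall sigma u, S2 p V u ->
    basis2 p V sigma u -> basis2 1 control_mesh sigma (I2 u);
  can3 : forall sigma u, S3 p V u ->
    basis3 p V sigma u -> basis3 1 control_mesh sigma (I3 u);
  comm_grad : forall phi u, S0 p V phi -> S1 p V u ->
    (is_grad D phi u <-> is_grad VC (I0 phi) (I1 u));
  comm_curl : forall u w, S1 p V u -> S2 p V w ->
    (is_curl D u w <-> is_curl VC (I1 u) (I2 w));
  comm_div : forall w rho, S2 p V w -> S3 p V rho ->
    (is_div D w rho <-> is_div VC (I2 w) (I3 rho)) }.

End ControlMesh.

(** * Cohomology *)

Section Cohomology.
Variable R : realType.

(** Kernel and image contain all the measurable functions that vanish a.e., so
    their quotient is also that of the corresponding spaces of a.e. classes. *)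
Definition Ker_curl (D : set (pt R)) (X1 : set (vect3 R)) : set (vect3 R) :=
  [set u | X1 u /\ is_curl D u (fun=> 0)].

Definition Im_grad (D : set (pt R)) (X0 : set (scal3 R)) (X1 : set (vect3 R)) :
    set (vect3 R) :=
  [set u | X1 u /\ exists2 phi, X0 phi & is_grad D phi u].

Variable U : lmodType R.

(** The [h j] lie in [K] and their classes generate [K / I]. *)
Definition generators (K I : set U) (n : nat) (h : 'I_n -> U) : Prop :=
  (forall j, K (h j)) /\
  forall u, K u -> exists c : 'I_n -> R, I (u - \sum_j c j *: h j).

Definition quotient_basis (K I : set U) (n : nat) (h : 'I_n -> U) : Prop :=
  generators K I h /\
  forall c : 'I_n -> R, I (\sum_j c j *: h j) -> forall j, c j = 0.

Definition quotient_dim (K I : set U) (n : nat) : Prop :=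
  exists h : 'I_n -> U, quotient_basis K I h.

End Cohomology.

(* Main.v *)
(* The vector fields of S_p^1 are determined, on the open patches, by finitely
   many coefficients.  The patches cover the domain up to the images of the
   boundary of the cube under Lipschitz maps, which are null; hence a field with
   zero coefficients vanishes almost everywhere and is a gradient, and the
   cohomology has finite dimension.  The isomorphisms I^0, I^1 map kernel onto
   kernel and image onto image up to null sets, so that I^1 carries bases and
   generators of the first quotient to those of the second. *)

Require Import Defs.
From HB Require Import structures.
From mathcomp Require Import all_boot all_order all_algebra all_fingroup.
From mathcomp Require Import all_classical all_reals all_analysis.
From mathcomp Require Import measurable_realfun ring.
Import Order.TTheory GRing.Theory Num.Theory.
Import numFieldNormedType.Exports.
Local Open Scope classical_set_scope.
Local Open Scope ring_scope.

Set Implicit Arguments.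
Unset Strict Implicit.
Unset Printing Implicit Defensive.

(** * Quotients of vector spaces *)

(** The coefficients form a nonzero row vector in the left kernel of an [m] by [#|T|] matrix, whose
    rank is at most [#|T| < m]. *)
Lemma dependent_family (F : fieldType) (T : finType) (m : nat)
    (c : 'I_m -> T -> F) : (#|T| < m)%N ->
  exists2 b : 'I_m -> F, exists j, b j != 0 & forall t, \sum_j b j * c j t = 0.
Proof.
move=> ltTm; pose A : 'M[F]_(m, #|T|) := \matrix_(j, k) c j (enum_val k).
have /rowV0Pn[v /sub_kermxP vA v0] : kermx A != 0.
  by rewrite kermx_eq0 /row_free neq_ltn (leq_ltn_trans (rank_leq_col A) ltTm).
exists (v 0); first by have /rV0Pn := v0.
move=> t; transitivity ((v *m A) 0 (enum_rank t)); last by rewrite vA mxE.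
by rewrite mxE; apply: eq_bigr => j _; rewrite mxE enum_rankK.
Qed.

(** An independent family of maximal length generates, since adding any further element of [K] makes
    it dependent modulo [I]. The second hypothesis bounds the possible lengths by [n]. *)
Lemma exists_quotient_dim (R : realType) (U : lmodType R) (K I : set U) (n : nat) :
  (forall (a : R) u, I u -> I (a *: u)) ->
  (forall m (h : 'I_m -> U), (n < m)%N -> (forall j, K (h j)) ->
    exists2 b : 'I_m -> R, exists j, b j != 0 & I (\sum_j b j *: h j)) ->
  exists m, quotient_dim K I m.
Proof.
move=> IZ dep.
pose indep m (h : 'I_m -> U) := forall c, I (\sum_j c j *: h j) -> forall j, c j = 0.
pose P m := `[< exists h : 'I_m -> U, (forall j, K (h j)) /\ indep m h >].
have P0 : exists m, P m.
  (* The empty family is independent. *)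
  by exists 0%N; apply/asboolP; exists (fun=> 0); split=> [[]//|c _ []//].
have Pn m : P m -> (m <= n)%N.
  move=> /asboolP[h [Kh ih]]; rewrite leqNgt; apply/negP => /dep/(_ Kh).
  by move=> [b [j /eqP bj] /ih].
have [m /asboolP[h [Kh ih]] maxm] := ex_maxnP P0 Pn.
exists m, h; split=> //; split=> // u Ku.
pose h' (j : 'I_m.+1) := if unlift ord0 j is Some k then h k else u.
have Kh' j : K (h' j) by rewrite /h'; case: unlift.
have : ~ indep m.+1 h'.
  move=> ih'; have : P m.+1 by apply/asboolP; exists h'.
  by move=> /maxm; rewrite ltnn.
move=> /existsNP[c /not_implyP[Ic /existsNP[j cj]]].
move: Ic; rewrite big_ord_recl /h' unlift_none.
under eq_bigr do rewrite liftK; move=> Ic.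
(* Otherwise the relation would involve the [h k] alone, and all its coefficients would vanish. *)
have c0 : c ord0 != 0.
  apply: contra_notN cj => /eqP c0; move: Ic; rewrite c0 scale0r add0r => /ih c'.
  by case: (unliftP ord0 j) => [k|] ->.
(* The relation is divided by [c ord0] and solved for [u]. *)
exists (fun k => - ((c ord0)^-1 * c (lift ord0 k))).
suff -> : u - \sum_k - ((c ord0)^-1 * c (lift ord0 k)) *: h k =
  (c ord0)^-1 *: (c ord0 *: u + \sum_k c (lift ord0 k) *: h k) by exact: IZ.
rewrite scalerDr scalerA mulVf // scale1r scaler_sumr -sumrN.
by congr (_ + _); apply: eq_bigr => k _; rewrite scaleNr opprK scalerA.
Qed.

Lemma closed_lincomb (R : realType) (U : lmodType R) (P : set U) :
  P 0 -> (forall (a : R) u v, P u -> P v -> P (a *: u + v)) ->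
  forall n (c : 'I_n -> R) (h : 'I_n -> U), (forall j, P (h j)) ->
  P (\sum_j c j *: h j).
Proof.
move=> P0 Plin n c h Ph; elim: n c h Ph => [|n IH] c h Ph; first by rewrite big_ord0.
by rewrite big_ord_recl; apply: Plin => //; exact: IH.
Qed.

(* In the application [r] is equality almost everywhere. *)
Section Transfer.
Context {R : realType} {U U' : lmodType R}.
Context {S K I : set U} {S' K' I' : set U'} {r : U' -> U' -> Prop} {f : U -> U'}.
Hypotheses (KS : K `<=` S) (KS' : K' `<=` S').
Hypothesis S_lin : forall (a : R) u v, S u -> S v -> S (a *: u + v).
Hypothesis S'_lin : forall (a : R) u v, S' u -> S' v -> S' (a *: u + v).
Hypotheses (S0 : S 0) (S'0 : S' 0).
Hypothesis r_lin :
  forall (a : R) u v u' v', r u u' -> r v v' -> r (a *: u + v) (a *: u' + v').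
Hypotheses (r_refl : forall u, r u u) (r_sym : forall u v, r u v -> r v u)
  (r_trans : forall u v w, r u v -> r v w -> r u w).
Hypothesis fS : forall u, S u -> S' (f u).
Hypothesis f_lin :
  forall (a : R) u v, S u -> S v -> r (f (a *: u + v)) (a *: f u + f v).
Hypothesis f_surj : forall v, S' v -> exists2 u, S u & r (f u) v.
Hypothesis K'_r : forall v w, S' v -> S' w -> r v w -> K' v -> K' w.
Hypothesis I'_r : forall v w, S' v -> S' w -> r v w -> I' v -> I' w.
Hypothesis K_f : forall u, S u -> (K u <-> K' (f u)).
Hypothesis I_f : forall u, S u -> (I u <-> I' (f u)).

(** As [f] is linear only up to [r], [- f 0] is added to both sides of the relation between
    [f (0 + 0)] and [f 0 + f 0]. *)
Lemma transfer0 : r (f 0) 0.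
Proof.
have := r_lin (-1) (r_refl (f 0)) (f_lin 1 S0 S0).
by rewrite scaler0 addr0 scale1r scaleN1r addNr addKr => /r_sym.
Qed.

Lemma transfer_sum n (c : 'I_n -> R) (h : 'I_n -> U) : (forall j, S (h j)) ->
  r (f (\sum_j c j *: h j)) (\sum_j c j *: f (h j)).
Proof.
elim: n c h => [|n IH] c h Sh; first by rewrite !big_ord0; exact: transfer0.
rewrite !big_ord_recl; apply: r_trans (f_lin _ _ _) _ => //.
  by apply: (closed_lincomb S0 S_lin) => j; exact: Sh.
by apply: r_lin => //; exact: IH.
Qed.

Lemma transfer_sumI n (c : 'I_n -> R) (h : 'I_n -> U) : (forall j, S (h j)) ->
  I (\sum_j c j *: h j) <-> I' (\sum_j c j *: f (h j)).
Proof.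
move=> Sh; have Sc := closed_lincomb S0 S_lin c Sh.
have S'c : S' (\sum_j c j *: f (h j)).
  by apply: (closed_lincomb S'0 S'_lin) => j; exact: fS.
have rc := transfer_sum c Sh.
rewrite I_f //; split; first by apply: I'_r => //; exact: fS.
by apply: I'_r => //; [exact: fS|exact: r_sym].
Qed.

(** The same coefficients serve on both sides: [f] sends [u - \sum_j c j *: h j] to
    [f u - \sum_j c j *: f (h j)] up to [r], and [I'] is stable under [r] on [S']. *)
Lemma transfer_generators n (h : 'I_n -> U) : (forall j, S (h j)) ->
  generators K I h <-> generators K' I' (f \o h).
Proof.
move=> Sh; have Sc c := closed_lincomb S0 S_lin c Sh.
have S'c (c : 'I_n -> R) : S' (\sum_j c j *: f (h j)).
  by apply: (closed_lincomb S'0 S'_lin) => j; exact: fS.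
have eqB (W : lmodType R) (x y : W) : x - y = -1 *: y + x.
  by rewrite scaleN1r addrC.
have subS u v : S u -> S v -> S (u - v).
  by move=> Su Sv; rewrite eqB; exact: S_lin.
have subS' u v : S' u -> S' v -> S' (u - v).
  by move=> Su Sv; rewrite eqB; exact: S'_lin.
have fI u v c : S u -> S' v -> r (f u) v ->
    I (u - \sum_j c j *: h j) <-> I' (v - \sum_j c j *: f (h j)).
  move=> Su Sv uv.
  have rr : r (f (u - \sum_j c j *: h j)) (v - \sum_j c j *: f (h j)).
    rewrite (eqB _ u) (eqB _ v).
    apply: r_trans (f_lin _ (Sc c) Su) _.
    by apply: r_lin => //; exact: transfer_sum.
  have S1 := fS (subS _ _ Su (Sc c)); have S2 := subS' _ _ Sv (S'c c).
  rewrite I_f; last exact: subS.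
  by split; apply: I'_r => //; exact: r_sym.
split=> -[Kh gen]; split=> [j|].
- by apply/K_f.
(* An element of [K'] is a value of [f] only up to [r]; stability of [K'] under [r] puts its
   preimage in [K]. *)
- move=> v Kv; have [u Su uv] := f_surj (KS' Kv).
  have Ku : K u.
    by apply/(K_f Su); apply: K'_r (KS' Kv) (fS Su) (r_sym uv) Kv.
  by have [c /(fI _ _ _ Su (KS' Kv) uv) Ic] := gen _ Ku; exists c.
- by apply/K_f => //; exact: Kh.
- move=> u Ku; have Su := KS Ku.
  have [c] := gen _ ((K_f Su).1 Ku).
  by move=> /(fI _ _ _ Su (fS Su) (r_refl _)) Ic; exists c.
Qed.

(** Independence pulls back: a relation modulo [I'] between the images is one modulo [I] between the
    [h j], with the same coefficients. *)
Lemma transfer_basis n (h : 'I_n -> U) : (forall j, S (h j)) ->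
  quotient_basis K I h -> quotient_basis K' I' (f \o h).
Proof.
move=> Sh [gen ind]; split; first exact/transfer_generators.
by move=> c /(transfer_sumI _ Sh) /ind.
Qed.

End Transfer.

(** * Lebesgue measure on R^3 *)

Section Measure.
Variable R : realType.
Local Notation R3 :=
  (measurableTypeR R * measurableTypeR R * measurableTypeR R)%type.
Implicit Types (D : set (pt R)) (f g e : scal3 R).

Lemma leb3_box (A B C : set (measurableTypeR R)) :
  measurable A -> measurable B -> measurable C ->
  @leb3 R (A `*` B `*` C) =
  (@lebesgue_measure R A * @lebesgue_measure R B * @lebesgue_measure R C)%E.
Proof.
move=> mA mB mC; rewrite /leb3 [LHS]product_measure1E //; last exact: measurableX.
by congr (_ * _)%E; rewrite [LHS]product_measure1E.
Qed.

Lemma vec3E (t : R3) (a : 'I_3) : vec3 t 0 a = nth 0 [:: t.1.1; t.1.2; t.2] a.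
Proof. by rewrite mxE. Qed.

Lemma coord_le_norm (x : pt R) (a : 'I_3) : `|x 0 a| <= `|x|.
Proof.
rewrite [leRHS]mx_normrE; apply/bigmax_geP; right => /=.
by exists (0, a).
Qed.

Lemma norm_le_coord (x : pt R) (M : R) :
  0 <= M -> (forall a, `|x 0 a| <= M) -> `|x| <= M.
Proof.
move=> M0 xM; rewrite [leLHS]mx_normrE; apply/bigmax_leP; split=> //.
by move=> [i a] _ /=; rewrite (ord1 i).
Qed.

(** Rounding the coordinates down to the grid of step 1/(n+1) gives functions that are constant on
    countably many boxes, hence measurable; by continuity they converge pointwise to [e \o vec3]. *)
Lemma measurable_comp_vec3 e : continuous e -> measurable_fun setT (e \o @vec3 R).
Proof.
move=> ce.
pose q n (k : int) : R := k%:~R / n.+1%:R.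
pose v n (k : int * int * int) : R3 := (q n k.1.1, q n k.1.2, q n k.2).
pose fl n (t : R3) := (Num.floor (t.1.1 * n.+1%:R),
  Num.floor (t.1.2 * n.+1%:R), Num.floor (t.2 * n.+1%:R)).
have flE n (x : R) k : (Num.floor (x * n.+1%:R) == k) = (x \in `[q n k, q n (k + 1)[).
  by rewrite floor_eq in_itv /= ler_pdivrMr ?ltr_pdivlMr ?ltr0n.
pose box n (k : int * int * int) : set R3 :=
  [set` `[q n k.1.1, q n (k.1.1 + 1)[] `*` [set` `[q n k.1.2, q n (k.1.2 + 1)[]
  `*` [set` `[q n k.2, q n (k.2 + 1)[].
have boxE n k t : box n k t <-> fl n t = k.
  case: k => [[k1 k2] k3]; rewrite /box /fl; split=> [[[]]/= |[<- <- <-]]; last first.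
    by rewrite /= -!flE !eqxx.
  by rewrite -!flE => /eqP -> /eqP -> /eqP ->.
apply: (@measurable_fun_cvg _ _ _ _ (fun n t => e (vec3 (v n (fl n t))))).
  move=> n _ Y mY; rewrite setTI.
  (* The preimage of [Y] is the union of the boxes at whose corner the value of [e] lies in [Y]. *)
  rewrite (_ : _ @^-1` _ =
      \bigcup_k (if `[< Y (e (vec3 (v n k))) >] then box n k else set0)).
    apply: countable_bigcupT_measurable => [|k]; first exact: countableP.
    by case: ifP => // _; do 2?[apply: measurableX]; exact: measurable_itv.
  apply/seteqP; split=> [t /= Yt|t [k _] /=].
    by exists (fl n t) => //; rewrite asboolT//; apply/boxE.
  by case: ifP => // /asboolP Yk /boxE ->.
move=> t _; apply: (@cvg_comp _ _ _ (fun n => vec3 (v n (fl n t))) e _ _ _ _ (ce _)).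
apply/cvgrPdist_le => eps eps0.
have [N _ hN] := near_infty_natSinv_lt (PosNum eps0).
near=> n.
have qx (x : R) : `|x - q n (Num.floor (x * n.+1%:R))| <= eps.
  have /hN /= : (N <= n)%N by near: n; exact: nbhs_infty_ge.
  move=> /ltW; apply: le_trans.
  have /andP[h1 h2] := floor_itv (x * n.+1%:R).
  rewrite ger0_norm ?subr_ge0 ?ler_pdivrMr ?ltr0n //.
  rewrite -(ler_pM2r (_ : 0 < n.+1%:R)) ?ltr0n // mulVf ?pnatr_eq0 //.
  rewrite mulrBl divfK ?pnatr_eq0 // lerBlDl addrC.
  by move: h2; rewrite intrD => /ltW; rewrite addrC.
apply: norm_le_coord => [|a]; first exact: ltW.
rewrite !mxE; case: a => -[|[|[|//]]] ? /=; exact: qx.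
Unshelve. all: by end_near.
Qed.

(** The square of [e] is at most a constant on a box containing [K] and vanishes outside that box,
    which has finite volume. *)
Lemma Lfun2_compact_support e (K : set (pt R)) :
  continuous e -> compact K -> (forall x, ~ K x -> e x = 0) ->
  e \o @vec3 R \in Lfun (@leb3 R) 2%:E.
Proof.
move=> ce cK e0.
have [M [_ KM]] := compact_bounded cK.
have [C [_ eC]] := compact_bounded (continuous_compact (continuous_subspaceT ce) cK).
(* [compact_bounded] provides bounds by any number strictly above [M] or [C]; the absolute values
   make the chosen ones positive. *)
pose m := `|M| + 1; pose c := `|C| + 1.
have m0 : 0 < m by rewrite ltr_wpDl.
have c0 : 0 < c by rewrite ltr_wpDl.
have {}KM x : K x -> `|x| <= m by apply: KM; rewrite ltr_pwDr // ler_norm.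
have {}eC x : `|e x| <= c.
  have [Kx|nK] := pselect (K x); last by rewrite e0 // normr0 ltW.
  by apply: (eC c); [rewrite ltr_pwDr // ler_norm|exists x].
pose I : set (measurableTypeR R) := [set` `[- m, m]].
have mI : measurable I by exact: measurable_itv.
pose B : set R3 := I `*` I `*` I.
have mB : measurable B by do 2?[apply: measurableX].
have me := measurable_comp_vec3 ce.
rewrite inE; apply/andP; split; rewrite inE //=.
rewrite /finite_norm unlock poweR_lty //.
apply: (@le_lt_trans _ _ (\int[@leb3 R]_(t in B) (cst (c ^+ 2)%:E) t)%E).
  rewrite [leRHS]integral_mkcond.
  rewrite [leLHS](eq_integral (fun t => (e (vec3 t) ^+ 2)%:E)); last first.
    move=> t _; rewrite [LHS](_ : _ = (`|e (vec3 t)| `^ 2%:R)%:E) //.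
    by rewrite powR_mulrn // real_normK ?num_real.
  apply: ge0_le_integral => //.
  - by move=> t _; rewrite lee_fin sqr_ge0.
  - by apply/measurable_EFinP/measurable_funX.
  - by apply/(measurable_restrictT _ mB); exact: measurable_cst.
  - move=> t _ /=; rewrite patchE; case: ifPn => [_|/negP tB].
      by rewrite lee_fin -[leLHS]real_normK ?num_real // ler_pXn2r // nnegrE // ltW.
    rewrite /= e0 ?expr0n //; move=> /KM Kt; apply: tB; rewrite inE.
    have h a := le_trans (coord_le_norm (vec3 t) a) Kt.
    have := h ord0; have := h (inord 1); have := h (inord 2).
    by rewrite !vec3E !inordK //= !ler_norml /B /I /= !in_itv /=.
rewrite integral_cst // leb3_box // lebesgue_measure_itv /= lte_fin gtrN //.
by rewrite -!EFinB -!EFinM ltry.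
Qed.

End Measure.

(** * Distributional operators and spline spaces *)

Section Operators.
Variable R : realType.
Local Notation R3 :=
  (measurableTypeR R * measurableTypeR R * measurableTypeR R)%type.
Implicit Types (D : set (pt R)) (f g e : scal3 R).

Lemma integral3E D f : integral3 D f = \int[@leb3 R]_t ((f \_ D) (vec3 t)).
Proof. by rewrite /integral3 Rintegral_mkcond. Qed.

(** The cut-off to [D] is put on the first factor, where [L2 D] expects it; the test factor is
    square integrable on the whole space. *)
Lemma patch_sum_mul D (I : finType) (u e : I -> scal3 R) x :
  ((fun y => \sum_a u a y * e a y) \_ D) x = \sum_a (u a \_ D) x * e a x.
Proof.
rewrite patchE; case: ifPn => xD; first by apply: eq_bigr => a _; rewrite patchE xD.
by rewrite big1 // => a _; rewrite patchE (negbTE xD) mul0r.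
Qed.

Lemma eq_Lfun2 (F G : R3 -> R) :
  F =1 G -> G \in Lfun (@leb3 R) 2%:E -> F \in Lfun (@leb3 R) 2%:E.
Proof. by move=> /funext ->. Qed.

Lemma L2_lin D (k : R) f g : L2 D f -> L2 D g -> L2 D (fun x => k * f x + g x).
Proof.
move=> Lf Lg.
apply: eq_Lfun2 ((Lfun_submod_closed (@leb3 R) (lee1n 2)).2 k _ _ Lf Lg) => t.
transitivity (k * (f \_ D) (vec3 t) + (g \_ D) (vec3 t)); last by [].
by rewrite !patchE; case: ifP; rewrite ?mulr0 ?addr0.
Qed.

Lemma L2_0 D : L2 D (fun=> 0).
Proof.
apply: eq_Lfun2 (Lfun_submod_closed (@leb3 R) (lee1n 2)).1 => t.
by rewrite patchE; case: ifP.
Qed.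

(** * Pairings of square integrable fields with test fields *)

Section Pairing.
Variables (D : set (pt R)) (I : finType).
Implicit Types u v : I -> scal3 R.
Variable e : I -> scal3 R.
Hypothesis Le : forall a, e a \o @vec3 R \in Lfun (@leb3 R) 2%:E.

(** Each summand is a product of two square integrable functions, so Hölder's inequality applies. *)
Lemma integrable_pairing u : (forall a, L2 D (u a)) ->
  (@leb3 R).-integrable setT
    (EFin \o (fun t => ((fun y => \sum_a u a y * e a y) \_ D) (vec3 t))).
Proof.
move=> Lu.
apply: (eq_integrable measurableT
  (fun t => \sum_a ((u a \_ D) (vec3 t) * e a (vec3 t))%:E)%E).
  by move=> t _ /=; rewrite patch_sum_mul sumEFin.
by apply: integrable_sum => // a _; apply/Lfun1_integrable/Lfun2_mul_Lfun1/Le/Lu.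
Qed.

Lemma integral3_lin (k : R) u v : (forall a, L2 D (u a)) -> (forall a, L2 D (v a)) ->
  integral3 D (fun x => \sum_a (k * u a x + v a x) * e a x) =
  k * integral3 D (fun x => \sum_a u a x * e a x)
  + integral3 D (fun x => \sum_a v a x * e a x).
Proof.
move=> Lu Lv; have iu := integrable_pairing Lu; have iv := integrable_pairing Lv.
rewrite !integral3E -RintegralZl // -RintegralD //.
  apply: eq_Rintegral => t _; rewrite !patch_sum_mul mulr_sumr -big_split /=.
  apply: eq_bigr => a _; rewrite !patchE; case: ifP => _.
    by rewrite mulrDl mulrA.
  by rewrite !mul0r mulr0 addr0.
exact: (integrableZl measurableT k iu).
Qed.

Lemma integral3_aeq u v : (forall a, L2 D (u a)) -> (forall a, L2 D (v a)) ->
  (forall a, aeq D (u a) (v a)) ->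
  integral3 D (fun x => \sum_a u a x * e a x) =
  integral3 D (fun x => \sum_a v a x * e a x).
Proof.
move=> Lu Lv uv; rewrite !integral3E /Rintegral; congr fine.
apply: ae_eq_integral => //.
- exact: (measurable_int _ (integrable_pairing Lu)).
- exact: (measurable_int _ (integrable_pairing Lv)).
(* Finitely many components: their exceptional null sets can be merged. *)
have : \forall t \ae @leb3 R, forall a, D (vec3 t) -> u a (vec3 t) = v a (vec3 t).
  exact: filter_forall.
apply: filterS => t uvt _ /=; rewrite !patchE; case: ifP => // tD; congr EFin.
by apply: eq_bigr => a _; rewrite uvt //; move: tD; rewrite inE.
Qed.

End Pairing.

Section ScalarPairing.
Variables (D : set (pt R)) (e : scal3 R).
Hypothesis Le : e \o @vec3 R \in Lfun (@leb3 R) 2%:E.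

(** Scalar pairings become vector pairings with a single component. *)
Let sum1 f : (fun x => f x * e x) = (fun x => \sum_(a < 1) f x * e x).
Proof. by apply/funext => x; rewrite big_ord1. Qed.

Lemma integral3_lin1 (k : R) f g : L2 D f -> L2 D g ->
  integral3 D (fun x => (k * f x + g x) * e x) =
  k * integral3 D (fun x => f x * e x) + integral3 D (fun x => g x * e x).
Proof.
move=> Lf Lg; rewrite !sum1.
exact: (@integral3_lin _ _ (fun=> e) _ _ (fun=> f) (fun=> g)).
Qed.

Lemma integral3_aeq1 f g : L2 D f -> L2 D g -> aeq D f g ->
  integral3 D (fun x => f x * e x) = integral3 D (fun x => g x * e x).
Proof.
move=> Lf Lg fg; rewrite !sum1.
exact: (@integral3_aeq _ _ (fun=> e) _ (fun=> f) (fun=> g)).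
Qed.

End ScalarPairing.

(** The complement of [K] is open, so near such a point [f] coincides with the zero function. *)
Lemma partial_support (K : set (pt R)) a f : closed K ->
  (forall x, ~ K x -> f x = 0) -> forall x, ~ K x -> partial a f x = 0.
Proof.
move=> cK f0 x nKx; rewrite /partial (@near_eq_derive _ _ _ _ (cst 0)).
  by rewrite derive_cst.
have : nbhs x (~` K) by apply: open_nbhs_nbhs; split=> //; exact: closed_openC.
by apply: filterS => y /f0.
Qed.

Lemma test_Lfun2 D psi :
  test_function D psi -> psi \o @vec3 R \in Lfun (@leb3 R) 2%:E.
Proof.
by move=> [sm [K [cK _ psi0]]]; exact: Lfun2_compact_support (sm [::]).1 cK psi0.
Qed.

Lemma partial_test_Lfun2 D psi a :
  test_function D psi -> partial a psi \o @vec3 R \in Lfun (@leb3 R) 2%:E.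
Proof.
move=> [sm [K [cK _ psi0]]]; apply: (Lfun2_compact_support (sm [:: a]).1 cK).
exact: partial_support (compact_closed (@norm_hausdorff R (pt R)) cK) psi0.
Qed.

Lemma curl_test_Lfun2 D psi a : (forall a, test_function D (psi a)) ->
  curl_test psi a \o @vec3 R \in Lfun (@leb3 R) 2%:E.
Proof.
move=> tpsi.
apply: eq_Lfun2 ((Lfun_submod_closed (@leb3 R) (lee1n 2)).2 (-1) _ _
  (partial_test_Lfun2 (ord_pred a) (tpsi (ordS a)))
  (partial_test_Lfun2 (ordS a) (tpsi (ord_pred a)))) => t /=.
by rewrite /curl_test addrC /= -scaleN1r.
Qed.

Lemma L2v_lin D (k : R) u v : L2v D u -> L2v D v -> L2v D (k *: u + v).
Proof.
move=> Lu Lv a.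
have -> : vcomp a (k *: u + v) = (fun x => k * vcomp a u x + vcomp a v x).
  by apply/funext => x; rewrite /vcomp !mxE.
exact: L2_lin (Lu a) (Lv a).
Qed.

Lemma L2v_0 D : L2v D 0.
Proof.
move=> a; rewrite (_ : vcomp a 0 = fun=> 0); first exact: L2_0.
by apply/funext => x; rewrite /vcomp mxE.
Qed.

(** Square integrability makes the integrands integrable, so that the pairings are additive. *)
Lemma is_grad_lin D (k : R) phi phi' u u' :
  L2 D phi -> L2 D phi' -> L2v D u -> L2v D u' ->
  is_grad D phi u -> is_grad D phi' u' ->
  is_grad D (fun x => k * phi x + phi' x) (k *: u + u').
Proof.
move=> L L' Lu Lu' g g' psi a tpsi.
rewrite integral3_lin1 //; last exact: (partial_test_Lfun2 _ tpsi).
rewrite g // g' //.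
have -> : (fun x => (k *: u + u') x 0 a * psi x) =
    (fun x => (k * vcomp a u x + vcomp a u' x) * psi x).
  by apply/funext => x; rewrite !mxE.
rewrite integral3_lin1 //; last exact: (test_Lfun2 tpsi).
by rewrite mulrN -opprD.
Qed.

Lemma is_grad_aeq D phi phi' u u' :
  L2 D phi -> L2 D phi' -> L2v D u -> L2v D u' -> aeq D phi phi' -> aeq D u u' ->
  is_grad D phi u -> is_grad D phi' u'.
Proof.
move=> L L' Lu Lu' e e' g psi a tpsi.
rewrite -(integral3_aeq1 (partial_test_Lfun2 _ tpsi) L L' e) g //.
congr (- _); apply: (integral3_aeq1 (test_Lfun2 tpsi) (Lu a) (Lu' a)).
by apply: filterS e' => t h Dt; rewrite /vcomp h.
Qed.

Let vcomp_linE (k : R) (u v : vect3 R) (psi : 'I_3 -> scal3 R) :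
  (fun x => \sum_a (k *: u + v) x 0 a * psi a x) =
  (fun x => \sum_a (k * vcomp a u x + vcomp a v x) * psi a x).
Proof. by apply/funext => x; apply: eq_bigr => a _; rewrite !mxE. Qed.

Lemma is_curl_lin D (k : R) u u' w w' :
  L2v D u -> L2v D u' -> L2v D w -> L2v D w' ->
  is_curl D u w -> is_curl D u' w' -> is_curl D (k *: u + u') (k *: w + w').
Proof.
move=> Lu Lu' Lw Lw' g g' psi tpsi.
have Lc a := curl_test_Lfun2 a tpsi; have Lt a := test_Lfun2 (tpsi a).
rewrite !vcomp_linE !integral3_lin //; congr (k * _ + _).
  exact: g.
exact: g'.
Qed.

Lemma is_curl_aeq D u u' w w' :
  L2v D u -> L2v D u' -> L2v D w -> L2v D w' -> aeq D u u' -> aeq D w w' ->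
  is_curl D u w -> is_curl D u' w'.
Proof.
move=> Lu Lu' Lw Lw' eu ew g psi tpsi.
have Lc a := curl_test_Lfun2 a tpsi; have Lt a := test_Lfun2 (tpsi a).
have comp u1 v1 : aeq D u1 v1 -> forall a, aeq D (@vcomp R a u1) (vcomp a v1).
  by move=> e a; apply: filterS e => t h Dt; rewrite /vcomp h.
apply: etrans (esym (integral3_aeq Lc Lu Lu' (comp _ _ eu))) _.
apply: etrans (g _ tpsi) _.
exact: (integral3_aeq Lt Lw Lw' (comp _ _ ew)).
Qed.

Lemma integral3_0 D : integral3 D (fun=> 0) = 0.
Proof.
rewrite integral3E (_ : (fun=> 0) \_ D = fun=> 0); last first.
  by apply/funext => x; rewrite patchE; case: ifP.
by rewrite /Rintegral integral0.
Qed.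

Let sum0 (e : 'I_3 -> scal3 R) :
  (fun x => \sum_a (0 : vect3 R) x 0 a * e a x) = fun=> 0.
Proof. by apply/funext => x; rewrite big1 // => a _; rewrite mxE mul0r. Qed.

Lemma is_grad_0 D : is_grad D (fun=> 0) 0.
Proof.
move=> psi a _; transitivity (integral3 D (fun=> 0)).
  by congr integral3; apply/funext => x /=; rewrite mul0r.
transitivity (- integral3 D (fun=> 0)); first by rewrite integral3_0 oppr0.
congr (- integral3 _ _).
by apply/funext => x /=; rewrite mxE mul0r.
Qed.

Lemma is_curl_0 D : is_curl D 0 0.
Proof. by move=> psi _; rewrite !sum0. Qed.

Lemma is_div_0 D : is_div D 0 (fun=> 0).
Proof.
move=> psi _; rewrite sum0 integral3_0.
transitivity (- integral3 D (fun=> 0)); first by rewrite integral3_0 oppr0.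
congr (- integral3 _ _).
by apply/funext => x /=; rewrite mul0r.
Qed.

End Operators.

(** * Linear structure of the spline spaces *)

Section SplineSpaces.
Variables (R : realType) (p : nat).

Lemma tcomb_lin (Q : nurbs_patch R) A (k : R) (c d : midx p Q A -> R) :
  tcomb (fun i => k * c i + d i) = (fun xi => k * tcomb c xi + tcomb d xi).
Proof.
apply/funext => xi; rewrite /tcomb mulr_sumr -big_split /=.
by apply: eq_bigr => i _; rewrite mulrDl mulrA.
Qed.

Lemma tspace_lin (Q : nurbs_patch R) A (k : R) f g :
  tspace p Q A f -> tspace p Q A g -> tspace p Q A (fun x => k * f x + g x).
Proof.
by move=> [c _ <-] [d _ <-]; exists (fun i => k * c i + d i); rewrite ?tcomb_lin.
Qed.

Lemma tspace_0 (Q : nurbs_patch R) A : tspace p Q A (fun=> 0).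
Proof.
exists (fun=> 0) => //; apply/funext => x.
by rewrite /tcomb big1 // => i _; rewrite mul0r.
Qed.

Lemma is_push_lin (Q : nurbs_patch R) (W : lmodType R) (k : R)
    (G H u v : pt R -> W) :
  is_push p Q G u -> is_push p Q H v ->
  is_push p Q (fun xi => k *: G xi + H xi) (fun x => k *: u x + v x).
Proof. by apply: filterS2 => t hG hH xi c e; rewrite (hG xi) // (hH xi). Qed.

Lemma is_push_0 (Q : nurbs_patch R) (W : lmodType R) :
  is_push p Q (fun=> 0 : W) (fun=> 0).
Proof. exact: aeW. Qed.

Lemma push1_lin (Q : nurbs_patch R) (k : R) g h u v :
  push1 p Q g u -> push1 p Q h v -> push1 p Q (k *: g + h) (k *: u + v).
Proof.
move=> gu hv; have := is_push_lin k gu hv; rewrite /push1.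
by under eq_fun do rewrite scalemxAl -mulmxDl.
Qed.

Variables (J : finType) (M : J -> nurbs_patch R).
Local Notation D := (domain p M).

Lemma S0_lin (k : R) u v :
  S0 p M u -> S0 p M v -> S0 p M (fun x => k * u x + v x).
Proof.
move=> [[Lu [du [Ldu gu]]] Su] [[Lv [dv [Ldv gv]]] Sv]; split.
  split; first exact: L2_lin.
  by exists (k *: du + dv); split; [exact: L2v_lin|exact: is_grad_lin].
move=> j; have [g Sg gu'] := Su j; have [h Sh hv] := Sv j.
exists (fun x => k * g x + h x); first exact: tspace_lin.
exact: (@is_push_lin _ R^o).
Qed.

Lemma S0_0 : S0 p M (fun=> 0).
Proof.
split; first by split; [exact: L2_0|exists 0; split; [exact: L2v_0|exact: is_grad_0]].
by move=> j; exists (fun=> 0); [exact: tspace_0|exact: (@is_push_0 _ R^o)].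
Qed.

Lemma S1_lin (k : R) u v : S1 p M u -> S1 p M v -> S1 p M (k *: u + v).
Proof.
move=> [[Lu [w [Lw gu]]] Su] [[Lv [z [Lz gv]]] Sv]; split.
  split; first exact: L2v_lin.
  by exists (k *: w + z); split; [exact: L2v_lin|exact: is_curl_lin].
move=> j; have [g Sg gu'] := Su j; have [h Sh hv] := Sv j.
exists (k *: g + h); last exact: push1_lin.
move=> a; have := tspace_lin k (Sg a) (Sh a).
by congr tspace; apply/funext => x; rewrite /vcomp !mxE.
Qed.

Lemma S1_0 : S1 p M 0.
Proof.
split; first by split; [exact: L2v_0|exists 0; split; [exact: L2v_0|exact: is_curl_0]].
move=> j; exists 0.
  move=> a; rewrite (_ : vcomp a 0 = fun=> 0); first exact: tspace_0.
  by apply/funext => x; rewrite /vcomp mxE.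
rewrite /push1; under eq_fun do rewrite mul0mx.
exact: is_push_0.
Qed.

(** The kernel of the curl is described by the value 0, which must lie in [S2] for the commutation
    with the curl to apply to it. *)
Lemma S2_0 : S2 p M 0.
Proof.
split.
  split; first exact: L2v_0.
  by exists (fun=> 0); split; [exact: L2_0|exact: is_div_0].
move=> j; exists 0.
  move=> a; rewrite (_ : vcomp a 0 = fun=> 0); first exact: tspace_0.
  by apply/funext => x; rewrite /vcomp mxE.
rewrite /push2; under eq_fun do rewrite mul0mx scaler0.
exact: is_push_0.
Qed.

End SplineSpaces.

(** * Boundaries of patches are null *)

Section NullBoundary.
Variable R : realType.
Local Notation R3 :=
  (measurableTypeR R * measurableTypeR R * measurableTypeR R)%type.

(** The intersection of covers of measure at most 1/(n+1) is a measurable null set containing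
    [A]. *)
Lemma negligible_le d (T : measurableType d) (mu : {measure set T -> \bar R})
    (A : set T) :
  (forall eps : R, 0 < eps ->
    exists B, [/\ measurable B, A `<=` B & (mu B <= eps%:E)%E]) ->
  mu.-negligible A.
Proof.
move=> hA; pose e n : R := n.+1%:R^-1.
have /choice[B hB] n : exists B, [/\ measurable B, A `<=` B & (mu B <= (e n)%:E)%E].
  by apply: hA; rewrite invr_gt0.
exists (\bigcap_n B n); split.
- by apply: bigcapT_measurable => n; case: (hB n).
- apply/eqP; rewrite -measure_le0; apply/lee_addgt0Pr => eps eps0.
  have [N _ /(_ N (leqnn N)) hN] := near_infty_natSinv_lt (PosNum eps0).
  have [mB _ leB] := hB N; rewrite add0e.
  apply: le_trans (le_trans leB _); last by rewrite lee_fin ltW.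
  apply: le_measure; rewrite ?inE //; last exact: bigcap_inf.
  by apply: bigcapT_measurable => n; case: (hB n).
- by move=> t At n _; case: (hB n) => _ AB _; exact: AB.
Qed.

Lemma measure_bigsetU_le d (T : measurableType d) (mu : {measure set T -> \bar R})
    (I : Type) (s : seq I) (A : I -> set T) (c : R) :
  (forall i, measurable (A i)) -> (forall i, (mu (A i) <= c%:E)%E) ->
  (mu (\big[setU/set0]_(i <- s) A i) <= (c *+ size s)%:E)%E.
Proof.
move=> mA leA; elim: s => [|i s IH]; first by rewrite big_nil measure0.
rewrite big_cons /= mulrS EFinD.
apply: le_trans (leeD (leA i) IH); apply: measureU2 => //.
exact: bigsetU_measurable.
Qed.

Lemma leb3_cube (y : pt R) (r : R) : 0 < r ->
  let I a : set (measurableTypeR R) := [set` `[y 0 a - r, y 0 a + r]] in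
  leb3 R (I ord0 `*` I (inord 1) `*` I (inord 2)) = ((2 * r) ^+ 3)%:E.
Proof.
move=> r0 I; rewrite leb3_box; try exact: measurable_itv.
rewrite !lebesgue_measure_itv /= !lte_fin !ltrD2l gtrN // -!EFinB -!EFinM.
by congr EFin; rewrite !opprD !opprK !exprS expr0; ring.
Qed.

(* The face is covered by at most (n+1)^2 sets of radius 1/n, whose images lie in
   cubes of side 2L/n: the total volume is O(1/n). *)
Lemma negligible_lipschitz_face (F : pt R -> pt R) (L : R) (a : 'I_3) (b : bool) :
  0 < L ->
  (forall xi eta, ccube xi -> ccube eta -> `|F xi - F eta| <= L * `|xi - eta|) ->
  (leb3 R).-negligible
    [set t | exists xi, [/\ ccube xi, xi 0 a = b%:R & F xi = vec3 t]].
Proof.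
move=> L0 lipF; apply: negligible_le => eps eps0.
(* At most (2n)^2 cubes of volume (2L/n)^3 have total volume 32 L^3 / n. *)
have e0 : 0 < eps / (32 * L ^+ 3) by rewrite divr_gt0 // mulr_gt0 // exprn_gt0.
have [m _ /(_ m (leqnn m)) hm] := near_infty_natSinv_lt (PosNum e0).
pose n : R := m.+1%:R; have n0 : 0 < n by rewrite ltr0n.
(* The n+1 grid values 0, 1/n, ..., 1, with n = m+1; the last one serves the coordinate 1. *)
pose K := 'I_m.+2.
pose c (k : K * K) : pt R := \row_i
  (if i == a then b%:R else if i == ordS a then k.1%:R / n else k.2%:R / n).
(* The Lipschitz bound sends points within 1/n of a grid point to points within [r] of its image. *)
pose r := L / n; have r0 : 0 < r by rewrite divr_gt0.
pose I (y : pt R) i : set (measurableTypeR R) := [set` `[y 0 i - r, y 0 i + r]].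
pose B k : set R3 :=
  I (F (c k)) ord0 `*` I (F (c k)) (inord 1) `*` I (F (c k)) (inord 2).
have mB k : measurable (B k) by do 2?[apply: measurableX]; exact: measurable_itv.
exists (\big[setU/set0]_(k <- enum {: K * K}) B k); split.
- exact: bigsetU_measurable.
- move=> t [xi [cxi xia Ft]].
  have kP i : exists k : K, `|xi 0 i - k%:R / n| <= n^-1.
    move: (cxi i); move: (xi 0 i) => y /andP[x0 x1].
    have /andP[k0 k1] : (Num.trunc (y * n))%:R <= y * n < (Num.trunc (y * n)).+1%:R.
      by apply: truncn_itv; rewrite mulr_ge0 // ltW.
    have km : (Num.trunc (y * n) < m.+2)%N.
      rewrite -(ltr_nat R); apply: le_lt_trans k0 _.
      apply: le_lt_trans (ler_wpM2r (ltW n0) x1) _; rewrite mul1r.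
      by rewrite ltr_nat.
    exists (Ordinal km) => /=.
    rewrite ger0_norm; last by rewrite subr_ge0 ler_pdivrMr.
    rewrite -(ler_pM2r n0) mulrBl divfK ?gt_eqF // mulVf ?gt_eqF //.
    by rewrite lerBlDl natr1 ltW.
  have [k1 hk1] := kP (ordS a); have [k2 hk2] := kP (ord_pred a).
  have xc : `|xi - c (k1, k2)| <= n^-1.
    apply: norm_le_coord => [|i]; first by rewrite invr_ge0 ltW.
    rewrite !mxE /=; case: eqVneq => [->|ia].
      by rewrite xia subrr normr0 invr_ge0 ltW.
    case: eqVneq => [->//|iSa]; suff -> : i = ord_pred a by [].
    apply/val_inj; move: ia iSa; rewrite -!val_eqE.
    by case: (a) (i) => [[|[|[|?]]] ?] [[|[|[|?]]] ?].
  (* The Lipschitz bound holds only between points of the closed cube. *)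
  have cc : ccube (c (k1, k2)).
    have h (k : K) : 0 <= k%:R / n <= 1.
      rewrite divr_ge0 ?ler0n ?(ltW n0) //= ler_pdivrMr // mul1r ler_nat.
      by rewrite -ltnS.
    move=> i; rewrite mxE; case: eqP => _; first by case: (b); rewrite /= ?lexx ler01.
    by case: eqP => _; exact: h.
  rewrite -bigcup_seq; exists (k1, k2); first by rewrite /= mem_enum.
  have h i : I (F (c (k1, k2))) i (vec3 t 0 i).
    rewrite /I /= in_itv /= -Ft -ler_distl.
    have := coord_le_norm (F xi - F (c (k1, k2))) i; rewrite !mxE => /le_trans; apply.
    apply: le_trans (lipF _ _ cxi cc) _.
    by rewrite /r ler_pM2l.
  have := h ord0; have := h (inord 1); have := h (inord 2).
  by rewrite !vec3E !inordK //= /B.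
- apply: le_trans (measure_bigsetU_le (c := (2 * r) ^+ 3) _ _ _) _ => //.
    by move=> k; rewrite leb3_cube.
  rewrite lee_fin -cardE card_prod card_ord -[leLHS]mulr_natl natrM.
  have hn : n^-1 * (32 * L ^+ 3) <= eps.
    by rewrite -ler_pdivlMr ?mulr_gt0 ?exprn_gt0 // ltW.
  apply: le_trans hn.
  have n2 : m.+2%:R <= 2 * n.
    by rewrite /n -natrM ler_nat mul2n -addnn addSn ltnS leq_addl.
  have -> : n^-1 * (32 * L ^+ 3) = (2 * n) * (2 * n) * (2 * r) ^+ 3.
    by rewrite /r; field; rewrite gt_eqF.
  apply: ler_wpM2r; first by rewrite exprn_ge0 // mulr_ge0 // ltW.
  by apply: ler_pM => //; rewrite ler0n.
Qed.

Lemma compact_ccube : compact (@ccube R).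
Proof.
have := @rV_compact R 3 (fun=> [set` `[0 : R, 1]]) (fun=> @segment_compact R 0 1).
by congr compact; apply/seteqP; split=> v h i; have := h i; rewrite /= in_itv.
Qed.

Section Patch.
Variables (p : nat) (Q : nurbs_patch R).
Hypothesis regQ : regular_map p Q.

(** A point of the closed cube outside the open one has a coordinate equal to 0 or 1, so six faces
    have to be treated. *)
Lemma negligible_boundary : (leb3 R).-negligible
  [set t | exists xi, [/\ ccube xi, ~ cube xi & Defs.pmap p Q xi = vec3 t]].
Proof.
have [L L0 lipF] := regQ.
have : \forall t \ae leb3 R, forall ab : 'I_3 * bool,
    ~ exists xi, [/\ ccube xi, xi 0 ab.1 = ab.2%:R & Defs.pmap p Q xi = vec3 t].
  apply: filter_forall => -[a b].
  have := @negligible_lipschitz_face (Defs.pmap p Q) L a b L0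
    (fun xi eta h h' => (lipF xi eta h h').1).
  (* An almost everywhere statement is the negligibility of its complement, here a double
     negation. *)
  by congr negligible; apply/seteqP; split=> t /= => [?|/contrapT].
apply: negligibleS => t [xi [cxi nxi Ft]] /= h; apply: nxi => a.
have /andP[x0 x1] := cxi a.
have na (b : bool) : xi 0 a <> b%:R by move=> xb; apply: (h (a, b)); exists xi.
have := na false; have := na true => /eqP n1 /eqP n0.
by rewrite !lt_neqAle x0 x1 n1 eq_sym n0.
Qed.

(** The image of the compact closed cube under a continuous map is closed. *)
Lemma closure_patch : closure (Defs.pmap p Q @` @cube R) `<=` Defs.pmap p Q @` @ccube R.
Proof.
have [L L0 lipF] := regQ.
have sub : Defs.pmap p Q @` @cube R `<=` Defs.pmap p Q @` @ccube R.
  by apply: image_subset => x cx a; have /andP[/ltW -> /ltW ->] := cx a.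
apply: subset_trans (closureS sub) _.
rewrite -(closure_id _).1 //.
apply: (compact_closed (@norm_hausdorff R (pt R))).
apply: continuous_compact compact_ccube.
apply/subspace_continuousP => x cx; apply/cvgrPdist_le => eps eps0.
rewrite near_withinE.
have h : \forall y \near x, `|x - y| <= eps / L.
  have eL : 0 < eps / L by rewrite divr_gt0.
  by apply/nbhs_normP; exists (eps / L) => // y /ltW.
apply: filterS h => y xy cy; apply: le_trans (lipF _ _ cx cy).1 _.
by rewrite mulrC -ler_pdivlMr.
Qed.

End Patch.

(** A point of the domain lies in a closed patch, so it comes either from the open cube, where [u]
    vanishes almost everywhere, or from the boundary, whose image is null. *)
Lemma vanish_on_domain (p : nat) (J : finType) (M : J -> nurbs_patch R) (W : zmodType)
    (u : pt R -> W) :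
  (forall j, regular_map p (M j)) -> (forall j, is_push p (M j) (fun=> 0) u) ->
  aeq (domain p M) u (fun=> 0).
Proof.
move=> regM u0.
have : \forall t \ae leb3 R, forall j,
    (forall xi, cube xi -> Defs.pmap p (M j) xi = vec3 t -> u (vec3 t) = 0) /\
    ~ exists xi, [/\ ccube xi, ~ cube xi & Defs.pmap p (M j) xi = vec3 t].
  apply: filter_forall => j; apply: filterI; first exact: u0.
  have := negligible_boundary (regM j).
  by congr negligible; apply/seteqP; split=> t /= => [?|/contrapT].
apply: filterS => t ut /interior_subset[j _ /(closure_patch (regM j))[xi cxi Ft]].
have [h1 h2] := ut j.
have [xic|nxi] := pselect (cube xi); first exact: h1 Ft.
by case: h2; exists xi.
Qed.

End NullBoundary.

(** * Cohomology *)

Section Cohomology.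
Variables (R : realType) (p : nat) (J : finType) (M : J -> nurbs_patch R).
Local Notation D := (domain p M).

(** Patch, component and tensor index. Matching across interfaces is ignored, so the cardinality
    only bounds the dimension from above. *)
Definition coef_idx : finType := {j : J & {a : 'I_3 & midx p (M j) [set a]}}.

Definition ref_field (c : coef_idx -> R) (j : J) : vect3 R := fun xi =>
  \row_a tcomb (fun i : midx p (M j) [set a] =>
    c (Tagged (fun j => {a : 'I_3 & midx p (M j) [set a]})
        (Tagged (fun a => midx p (M j) [set a]) i))) xi.

Lemma S1_coef u : S1 p M u -> exists c, forall j, push1 p (M j) (ref_field c j) u.
Proof.
move=> [_ Su].
have H j : exists d : forall a, midx p (M j) [set a] -> R,
    push1 p (M j) (fun xi => \row_a tcomb (d a) xi) u.
  have [g Sg gu] := Su j; exists (fun a => s2val (cid2 (Sg a))).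
  rewrite (_ : (fun xi => _) = g) //; apply/funext => xi; apply/rowP => a.
  by rewrite mxE (s2valP' (cid2 (Sg a))).
pose d j := projT1 (cid (H j)).
exists (fun t => d (tag t) (tag (tagged t)) (tagged (tagged t))) => j.
exact: (projT2 (cid (H j))).
Qed.

(** A linear relation between the coefficient families holds between the fields themselves on every
    open patch. *)
Lemma S1_dependent m (h : 'I_m -> vect3 R) :
  (forall j, regular_map p (M j)) -> (#|coef_idx| < m)%N ->
  (forall k, S1 p M (h k)) ->
  exists2 b : 'I_m -> R, exists k, b k != 0 & aeq D (\sum_k b k *: h k) 0.
Proof.
move=> regM ltm Sh.
have /choice[c hc] k := S1_coef (Sh k).
have [b b0 bc] := dependent_family c ltm; exists b => //.
apply: vanish_on_domain regM _ => j.
have : \forall t \ae leb3 R, forall k, forall xi, cube xi ->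
    Defs.pmap p (M j) xi = vec3 t ->
    h k (vec3 t) = ref_field (c k) j xi *m invmx (DF p (M j) xi).
  by apply: filter_forall => k; exact: hc.
apply: filterS => t ht xi cxi Fxi; rewrite fct_sumE.
under eq_bigr => k _ do
  rewrite (_ : (b k *: h k) _ = b k *: h k (vec3 t)) // (ht k xi) // scalemxAl.
(* The inverse Jacobian does not depend on [k] and factors out, leaving a combination of reference
   fields with zero coefficients. *)
rewrite -mulmx_suml (_ : \sum_k _ = 0) ?mul0mx //.
apply/rowP => a; rewrite summxE mxE.
under eq_bigr => k _ do rewrite !mxE /tcomb mulr_sumr.
rewrite exchange_big big1 //= => i _.
under eq_bigr => k _ do rewrite mulrA.
by rewrite -mulr_suml bc mul0r.
Qed.

Lemma Im_gradZ (k : R) u :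
  Im_grad D (S0 p M) (S1 p M) u -> Im_grad D (S0 p M) (S1 p M) (k *: u).
Proof.
move=> [Su [phi Sphi gu]]; split.
  by rewrite -[k *: u]addr0; apply: S1_lin => //; exact: S1_0.
exists (fun x => k * phi x + 0); first exact: S0_lin Sphi (S0_0 _ _).
rewrite -[k *: u]addr0; apply: is_grad_lin => //; last exact: is_grad_0.
- by case: Sphi => -[].
- exact: L2_0.
- by case: Su => -[].
- exact: L2v_0.
Qed.

(** The same potential serves, since the pairings do not see null sets. *)
Lemma Im_grad_aeq u v : S1 p M v -> aeq D u v ->
  Im_grad D (S0 p M) (S1 p M) u -> Im_grad D (S0 p M) (S1 p M) v.
Proof.
move=> Sv uv [Su [phi Sphi gu]]; split=> //; exists phi => //.
have Lphi : L2 D phi by case: Sphi => -[].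
have Lu : L2v D u by case: Su => -[].
have Lv : L2v D v by case: Sv => -[].
by apply: is_grad_aeq gu => //; exact: aeW.
Qed.

Lemma Ker_curl_aeq u v : S1 p M v -> aeq D u v ->
  Ker_curl D (S1 p M) u -> Ker_curl D (S1 p M) v.
Proof.
move=> Sv uv [Su cu]; split=> //.
have Lu : L2v D u by case: Su => -[].
have Lv : L2v D v by case: Sv => -[].
by apply: is_curl_aeq cu => //; [exact: L2v_0|exact: L2v_0|exact: aeW].
Qed.

(** More fields than coefficients have a combination vanishing almost everywhere, which is a
    gradient with potential 0. *)
Lemma exists_cohomology_dim : (forall j, regular_map p (M j)) ->
  exists n, quotient_dim (Ker_curl D (S1 p M)) (Im_grad D (S0 p M) (S1 p M)) n.
Proof.
move=> regM; apply: (@exists_quotient_dim _ _ _ _ #|coef_idx|).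
  by move=> k u; exact: Im_gradZ.
move=> m h ltm Kh; have Sh j : S1 p M (h j) by case: (Kh j).
have [b b0 bh] := S1_dependent regM ltm Sh; exists b => //.
apply: (@Im_grad_aeq 0).
- exact: closed_lincomb (S1_0 _ _) (@S1_lin _ _ _ _) _ _ _ Sh.
- by apply: filterS bh => t + Dt => ->.
- split; first exact: S1_0.
  by exists (fun=> 0); [exact: S0_0|exact: is_grad_0].
Qed.

End Cohomology.

(** * Transfer of the cohomology from the splines to the control mesh *)

Theorem proposition1 (R : realType) (p N : nat) (hp : (1 <= p)%N)
  (hN : (1 <= N)%N) (V : 'I_N -> nurbs_patch R)
  (hV : multipatch p V) (hVC : valid_control_mesh p V)
  (I0 : ('rV[R]_3 -> R) -> ('rV[R]_3 -> R))
  (I1 : ('rV[R]_3 -> 'rV[R]_3) -> ('rV[R]_3 -> 'rV[R]_3))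
  (I2 : ('rV[R]_3 -> 'rV[R]_3) -> ('rV[R]_3 -> 'rV[R]_3))
  (I3 : ('rV[R]_3 -> R) -> ('rV[R]_3 -> R))
  (hI : canonical_isomorphisms p V I0 I1 I2 I3) :
  let KerV := Ker_curl (domain p V) (S1 p V) in
  let ImV := Im_grad (domain p V) (S0 p V) (S1 p V) in
  let KerVC := Ker_curl (VC p V) (Z1 p V) in
  let ImVC := Im_grad (VC p V) (Z0 p V) (Z1 p V) in
  exists NH : nat,
    [/\ quotient_dim KerV ImV NH,
        quotient_dim KerVC ImVC NH
      & forall h : 'I_NH -> ('rV[R]_3 -> 'rV[R]_3),
          (forall j, S1 p V (h j)) ->
          (generators KerV ImV h <-> generators KerVC ImVC (fun j => I1 (h j)))].
Proof.
move=> KerV ImV KerVC ImVC.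
have [NH dimV] : exists n, quotient_dim KerV ImV n.
  by apply: exists_cohomology_dim => j; have [/(_ j)[_ _ ?] _] := hV.
have [I0S I0lin I0eq I0surj] := iso0 hI.
have [I1S I1lin I1eq I1surj] := iso1 hI.
have [I2S I2lin I2eq I2surj] := iso2 hI.
have r_lin (a : R) (u v u' v' : vect3 R) : aeq (VC p V) u u' -> aeq (VC p V) v v' ->
    aeq (VC p V) (a *: u + v) (a *: u' + v').
  by apply: filterS2 => t hu hv Dt; congr (_ *: _ + _); [exact: hu|exact: hv].
have r_refl (u : vect3 R) : aeq (VC p V) u u by exact: aeW.
have r_sym (u v : vect3 R) : aeq (VC p V) u v -> aeq (VC p V) v u.
  by apply: filterS => t uv Dt; rewrite uv.
have r_trans (u v w : vect3 R) :
    aeq (VC p V) u v -> aeq (VC p V) v w -> aeq (VC p V) u w.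
  by apply: filterS2 => t uv vw Dt; rewrite uv ?vw.
(* [I2] is linear only almost everywhere, so [I2 0] has to be identified with 0 before the two
   kernels can be compared. *)
have I20 := transfer0 (S2_0 p V) r_lin r_refl r_sym I2lin.
have K_f u : S1 p V u -> (KerV u <-> KerVC (I1 u)).
  move=> Su; have := comm_curl hI Su (S2_0 p V) => cc; have Z1u := I1S _ Su.
  have Lu : L2v (VC p V) (I1 u) by case: Z1u => -[].
  have L0 : L2v (VC p V) (I2 0) by have [[]] := I2S _ (S2_0 p V).
  split=> -[_ cu]; split=> //.
    by apply: is_curl_aeq (cc.1 cu) => //; exact: L2v_0.
  by apply/cc; apply: is_curl_aeq cu => //; [exact: L2v_0|exact: r_sym].
have I_f u : S1 p V u -> (ImV u <-> ImVC (I1 u)).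
  move=> Su; have Z1u := I1S _ Su.
  split=> -[_ [phi Sphi gu]]; split=> //.
    by exists (I0 phi); [exact: I0S|exact/(comm_grad hI)].
  (* The given potential on the control mesh is only almost everywhere equal to some [I0 phi'];
     [is_grad] tolerates the difference. *)
  have [phi' Sphi' e] := I0surj _ Sphi; exists phi' => //.
  apply/(comm_grad hI) => //.
  have Lu : L2v (VC p V) (I1 u) by case: Z1u => -[].
  have L0 : L2 (VC p V) phi by case: Sphi => -[].
  have L0' : L2 (VC p V) (I0 phi') by have [[]] := I0S _ Sphi'.
  apply: is_grad_aeq gu => //.
  by apply: filterS e => t et Dt; rewrite et.
have KS : KerV `<=` S1 p V by move=> u [].
have KS' : KerVC `<=` Z1 p V by move=> u [].
have K'_r u v : Z1 p V u -> Z1 p V v -> aeq (VC p V) u v -> KerVC u -> KerVC v.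
  by move=> _; exact: Ker_curl_aeq.
have I'_r u v : Z1 p V u -> Z1 p V v -> aeq (VC p V) u v -> ImVC u -> ImVC v.
  by move=> _; exact: Im_grad_aeq.
have S_lin := @S1_lin R p _ V; have Z_lin := @S1_lin R 1 _ (@control_mesh R p _ V).
have gens := transfer_generators KS KS' S_lin Z_lin (S1_0 _ _) (S1_0 _ _)
  r_lin r_refl r_sym r_trans I1S I1lin I1surj K'_r I'_r K_f I_f.
exists NH; split=> //; last by move=> h Sh; exact: gens.
(* The images under [I1] of a basis of the spline quotient give the same dimension on the control
   mesh. *)
have [h bh] := dimV; exists (I1 \o h).
have Sh j : S1 p V (h j) by case: bh => -[/(_ j)/KS].
exact: (transfer_basis KS KS' S_lin Z_lin (S1_0 _ _) (S1_0 _ _)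
  r_lin r_refl r_sym r_trans I1S I1lin I1surj K'_r I'_r K_f I_f Sh bh).
Qed.
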